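(* Consider $(1,2)$-square tilings of an $n\times n$ toroidal region and the weighted Markov chain $\mathrm{MC}_{(1,2)\text{-}square}$ with parameter $\lambda>0$. If $\lambda\le \frac13$ the chain is rapidly mixing; more precisely there are positive constants $c_1,c_2$ such that: (1) if $\lambda<1/3$, then $\tau_{mix}(\varepsilon)\le c_1 n^2\log(n\varepsilon^{-1})$; (2) if $\lambda=1/3$, then $\tau_{mix}(\varepsilon)\le c_2 n^4\lceil(\log n+1)\log\varepsilon^{-1}\rceil$.
   Context: A $(1,2)$-tiling is a tiling by $1\times1$ and $2\times2$ squares. The chain $\mathrm{MC}_{(1,2)\text{-}square}$ with weight $\lambda>0$: at each step choose a site of the region uniformly at random; if a central flip can be made there (the relevant $2\times2$ block is either one $2\times2$ square or four unit squares), put four $1\times1$ squares with probability $\frac1{\lambda+1}$ and a $2\times2$ square with probability $\frac{\lambda}{\lambda+1}$; else, if a horizontal, vertical, or diagonal dragging flip can be made (moving a $2\times2$ square by one unit horizontally, vertically, or diagonally, into space occupied by unit squares), perform it with probability $\frac{\lambda}{4(\lambda+1)}$; otherwise do nothing. Its stationary distribution gives a tiling $X$ probability proportional to $\lambda^{\#\{2\times 2\text{ squares in }X\}}$. Mixing time: with $d_x(t)=\frac12\sum_y|P^t(x,y)-\pi(y)|$, $\tau_{mix}(\varepsilon)=\max_x\min\{t:d_x(t')\le\varepsilon\ \forall t'\ge t\}$. *)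

(* Defs.v *)
From HB Require Import structures.
From mathcomp Require Import all_boot all_order all_algebra.
From mathcomp Require Import all_classical all_reals all_analysis.

Set Implicit Arguments.
Unset Strict Implicit.
Unset Printing Implicit Defensive.

Import Order.TTheory GRing.Theory Num.Theory.
Local Open Scope ring_scope.

(* Unit cells of the n x n torus; [ordS] is the cyclic successor of 'I_n.      *)
Definition site (n : nat) : Type := ('I_n * 'I_n)%type.

(* A site also names the 2 x 2 block having it as lower-left cell.  The block  *)
(* is a list, not a set: for n = 1 it lists the same cell four times.          *)
Definition block n (v : site n) : seq (site n) :=
  [:: v; (ordS v.1, v.2); (v.1, ordS v.2); (ordS v.1, ordS v.2)].

(* (false, c) is the 1 x 1 square on the cell c, and (true, v) is the 2 x 2    *)
(* square whose lower-left cell is v.                                          *)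
Definition tile (n : nat) : Type := (bool * site n)%type.

Definition small n (c : site n) : tile n := (false, c).
Definition big n (v : site n) : tile n := (true, v).

Definition cells n (t : tile n) : seq (site n) :=
  if t.1 then block t.2 else [:: t.2].

(* Coverage is counted with multiplicity, so a 2 x 2 square that would wrap    *)
(* onto itself (n = 1) never belongs to a tiling.                              *)
Definition is_tiling n (X : {set tile n}) : bool :=
  [forall c : site n, (\sum_(t in X) count_mem c (cells t))%N == 1%N].

Definition tiling (n : nat) : Type := {X : {set tile n} | is_tiling X}.

Definition nb_big n (X : {set tile n}) : nat := #|[set t in X | t.1]|.

Section Flips.
Variable n : nat.
Implicit Types (X : {set tile n}) (u v : site n).

Definition smalls v : {set tile n} := [set small c | c in block v].

Definition has_big X v : bool := big v \in X.

Definition four_smalls X v : bool := uniq (block v) && (smalls v \subset X).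

Definition central_ok X v : bool := has_big X v || four_smalls X v.

Definition put_smalls X v : {set tile n} := (X :\ big v) :|: smalls v.

Definition put_big X v : {set tile n} := big v |: (X :\: smalls v).

Definition near (i j : 'I_n) : bool := [|| i == j, ordS i == j | ordS j == i].

Definition adjacent u v : bool := [&& u != v, near u.1 v.1 & near u.2 v.2].

(* The 2 x 2 square at u can be moved by one unit, horizontally, vertically or *)
(* diagonally, onto the block of v.  In a tiling such a u is unique, since any *)
(* other 2 x 2 square meeting the block of v would occupy a cell required to   *)
(* be a unit square.                                                           *)
Definition drag_ok X v u : bool :=
  [&& has_big X u, adjacent u v &
      all (fun c => (c \in block u) || (small c \in X)) (block v)].

Definition drag X v u : {set tile n} := put_big (put_smalls X u) v.

End Flips.

Section Chain.
Variables (R : realType) (n : nat) (lambda : R).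
Implicit Types (v : site n) (X Y : tiling n).

(* Probability of moving from X to Y once the site v has been chosen.          *)
Definition site_step v X Y : R :=
  let x := val X in let y := val Y in
  if central_ok x v then
    1 / (lambda + 1) * (y == put_smalls x v)%:R
    + lambda / (lambda + 1) * (y == put_big x v)%:R
  else if [pick u | drag_ok x v u] is Some u then
    let q := lambda / (4 * (lambda + 1)) in
    q * (y == drag x v u)%:R + (1 - q) * (y == x)%:R
  else (y == x)%:R.

Definition MC_square X Y : R := (\sum_v site_step v X Y) / (n ^ 2)%:R.

Definition weight X : R := lambda ^+ nb_big (val X).

Definition gibbs X : R := weight X / \sum_(Y : tiling n) weight Y.

End Chain.

Section MixingTime.
Variables (R : realType) (T : finType) (P : T -> T -> R) (pi : T -> R).

Fixpoint step_pow (t : nat) (x y : T) : R :=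
  if t is t'.+1 then \sum_z P x z * step_pow t' z y else (x == y)%:R.

Definition tv_dist (x : T) (t : nat) : R :=
  2^-1 * \sum_y `|step_pow t x y - pi y|.

(* The infimum is the minimum of a set of naturals, or +oo if the set is       *)
(* empty.                                                                      *)
Definition mixing_time_from (x : T) (eps : R) : \bar R :=
  ereal_inf [set (t%:R)%:E | t in
    [set t : nat | forall t' : nat, (t <= t')%N -> tv_dist x t' <= eps]].

Definition mixing_time (eps : R) : \bar R :=
  \big[maxe/-oo%E]_(x : T) mixing_time_from x eps.

End MixingTime.

(* Main.v *)
(** The 2 x 2 squares of a tiling form an independent set of the king's graph on
    the torus (degree at most 8), and this is a bijection for n > 1; the chain
    becomes the insert/delete/drag chain of Dyer and Greenhill for the hard-core
    model.  Two copies are driven by the same site and the same coin.  If they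
    differ in one square, the expected Hamming distance d after one step is at
    most 1 - (1 - 16 q) / n^2, where q = lambda / (4 (lambda + 1)) is the drag
    probability and 16 q <= 1 iff lambda <= 1/3; telescoping through the
    intersection extends this to any two copies, which settles lambda < 1/3.

    For lambda = 1/3, d is only a supermartingale, but at each of the d sites of
    disagreement a deletion lowers it, so its one-step variance is at least of
    order d / n^2.  Hence exp (- theta_s d) with theta_s = 1 / (1 + k s) and k of
    order 1 / n^2 satisfies E exp (- theta_s d') >= exp (- theta_(s+1) d): as for
    a critical branching process, coalescence occurs within O(n^4) steps with
    probability bounded below, uniformly in the starting points, and one
    restarts. *)

Require Import Defs.
From HB Require Import structures.
From mathcomp Require Import all_boot all_order all_algebra.
From mathcomp Require Import all_classical all_reals all_analysis.
From mathcomp Require Import ring lra fintype finset.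

(* The analysis library also has names [near] and [adjacent]. *)
Import Defs.

Set Implicit Arguments.
Unset Strict Implicit.
Unset Printing Implicit Defensive.

Import Order.TTheory GRing.Theory Num.Theory.
Local Open Scope ring_scope.

(** * Random maps and coupling *)

Section RandomMaps.
Variables (R : realType) (T S : finType) (P : T -> T -> R) (pi : T -> R).
Variables (p : S -> R) (f : S -> T -> T).
Hypothesis p_ge0 : forall r, 0 <= p r.
Hypothesis p_sum : \sum_r p r = 1.
Hypothesis P_maps : forall x y, P x y = \sum_r p r * (f r x == y)%:R.

Definition coupled_avg (g : T -> T -> R) (x z : T) : R :=
  \sum_r p r * g (f r x) (f r z).

(** The probability that the copies started at [x] and [z] still differ after [t] shared seeds,
    obtained by iterating an operator rather than on a space of trajectories. *)
Definition uncoupled (t : nat) : T -> T -> R :=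
  iter t coupled_avg (fun x z => (x != z)%:R).

Lemma coupled_avg_le (g h : T -> T -> R) :
  (forall x z, g x z <= h x z) -> forall x z, coupled_avg g x z <= coupled_avg h x z.
Proof. by move=> gh x z; apply: ler_sum => r _; apply: ler_wpM2l. Qed.

Lemma coupled_avgZ (c : R) (g : T -> T -> R) x z :
  coupled_avg (fun x z => c * g x z) x z = c * coupled_avg g x z.
Proof. by rewrite /coupled_avg mulr_sumr; apply: eq_bigr => r _; ring. Qed.

(** Copies that have met are moved by the same map and stay together; monotonicity of [coupled_avg]
    carries this to later times. *)
Lemma uncoupledS_le t x z : uncoupled t.+1 x z <= uncoupled t x z.
Proof.
elim: t x z => [|t IHt] x z; last exact: coupled_avg_le.
rewrite /uncoupled /= /coupled_avg -[leRHS]mul1r -[X in _ <= X * _]p_sum mulr_suml.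
apply: ler_sum => r _; apply: ler_wpM2l => //.
rewrite /= ler_nat; case: (eqVneq x z) => [->|_]; first by rewrite eqxx.
exact: leq_b1.
Qed.

Lemma uncoupled_le_mono s t x z : (s <= t)%N -> uncoupled t x z <= uncoupled s x z.
Proof.
move=> /subnK<-; elim: (t - s)%N => // k IHk.
by rewrite addSn (le_trans (uncoupledS_le _ _ _)).
Qed.

Lemma uncoupled_le1 t x z : uncoupled t x z <= 1.
Proof. by rewrite (le_trans (uncoupled_le_mono _ _ (leq0n t))) // lern1 leq_b1. Qed.

Lemma uncoupled_same t x : uncoupled t x x = 0.
Proof.
elim: t x => [|t IHt] x; first by rewrite /uncoupled /= eqxx.
by rewrite /uncoupled iterS -/(uncoupled t) /coupled_avg big1 // => r _; rewrite IHt mulr0.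
Qed.

(** Comparison principle for the backward equation. It serves both regimes: [u] is a decaying
    multiple of the distance below criticality, and 1 minus an exponential of it at criticality. *)
Lemma uncoupled_supersolution (c : R) (u : nat -> T -> T -> R) :
  (forall x z, c * (x != z)%:R <= u 0%N x z) ->
  (forall s x z, coupled_avg (u s) x z <= u s.+1 x z) ->
  forall t x z, c * uncoupled t x z <= u t x z.
Proof.
move=> u0 uS; elim=> [|t IHt] x z; first exact: u0.
rewrite /uncoupled iterS -/(uncoupled t) -coupled_avgZ.
exact: (le_trans (coupled_avg_le IHt _ _)).
Qed.

Lemma uncoupled_expn s (rho : R) : 0 <= rho ->
  (forall x z, uncoupled s x z <= rho) ->
  forall m x z, uncoupled (m * s) x z <= rho ^+ m.
Proof.
move=> rho0 s_rho; elim=> [|m IHm] x z; first by rewrite uncoupled_le1.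
(* Copies that met within the first [t] steps stay together; any other pair has [s] fresh steps,
   which fail with probability at most [rho]. *)
have restart t : forall x z, uncoupled (t + s) x z <= rho * uncoupled t x z.
  elim: t => [|t IHt] {}x {}z.
    case: (eqVneq x z) => [->|xz]; first by rewrite !uncoupled_same mulr0.
    by rewrite (le_trans (s_rho _ _)) // /uncoupled /= xz mulr1.
  rewrite addSn /uncoupled !iterS -/(uncoupled _) -coupled_avgZ.
  exact: coupled_avg_le.
by rewrite mulSn addnC (le_trans (restart _ _ _)) // exprS ler_wpM2l.
Qed.

Lemma step_powS t x y : step_pow P t.+1 x y = \sum_r p r * step_pow P t (f r x) y.
Proof.
rewrite /=; under eq_bigr do rewrite P_maps mulr_suml.
rewrite exchange_big; apply: eq_bigr => r _.
rewrite (bigD1 (f r x)) //= eqxx mulr1 big1 ?addr0 // => z.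
by rewrite eq_sym => /negPf->; rewrite mulr0 mul0r.
Qed.

(** Coupling inequality: both laws are averaged over the same seed. The factor 2 is the L1 distance
    of two distinct point masses. *)
Lemma step_pow_dist t x z :
  \sum_y `|step_pow P t x y - step_pow P t z y| <= 2 * uncoupled t x z.
Proof.
elim: t x z => [|t IHt] x z.
  rewrite /uncoupled /=; case: (eqVneq x z) => [->|xz].
    by rewrite mulr0 big1 // => y _; rewrite subrr normr0.
  have ind w : \sum_y (w == y)%:R = 1 :> R.
    rewrite (bigD1 w) //= eqxx big1 ?addr0 // => y.
    by rewrite eq_sym => /negPf->.
  apply: (@le_trans _ _ (\sum_y ((x == y)%:R + (z == y)%:R))).
    by apply: ler_sum => y _; rewrite (le_trans (ler_normB _ _)) // !ger0_norm.
  by rewrite big_split /= !ind mulr1.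
rewrite /uncoupled iterS -/(uncoupled t) -coupled_avgZ.
under eq_bigr do rewrite !step_powS -sumrB.
apply: (@le_trans _ _ (\sum_y \sum_r
    p r * `|step_pow P t (f r x) y - step_pow P t (f r z) y|)).
  apply: ler_sum => y _; rewrite (le_trans (ler_norm_sum _ _ _)) //.
  by apply: ler_sum => r _; rewrite -mulrBr normrM ger0_norm.
rewrite exchange_big; apply: ler_sum => r _.
by rewrite -mulr_sumr ler_wpM2l.
Qed.

Hypothesis pi_ge0 : forall x, 0 <= pi x.
Hypothesis pi_sum : \sum_x pi x = 1.
Hypothesis pi_rev : forall x y, pi x * P x y = pi y * P y x.

Lemma step_pow_stationary t y : \sum_z pi z * step_pow P t z y = pi y.
Proof.
elim: t => [|t IHt] /=.
  rewrite (bigD1 y) //= eqxx mulr1 big1 ?addr0 // => z /negPf->.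
  by rewrite mulr0.
under eq_bigr do rewrite mulr_sumr.
rewrite exchange_big /= -[RHS]IHt; apply: eq_bigr => w _.
under eq_bigr do rewrite mulrA pi_rev.
rewrite -mulr_suml -mulr_sumr; congr (_ * _); rewrite -[RHS]mulr1; congr (_ * _).
(* The rows of [P] sum to 1, since each seed sends [w] to exactly one state. *)
under eq_bigr do rewrite P_maps.
rewrite exchange_big -[RHS]p_sum; apply: eq_bigr => r _.
rewrite (bigD1 (f r w)) //= eqxx mulr1 big1 ?addr0 // => z.
by rewrite eq_sym => /negPf->; rewrite mulr0.
Qed.

(** By stationarity [pi] is the [pi]-average over [z] of the laws started at [z], so a bound for
    every pair of starting points suffices. *)
Lemma tv_dist_le_uncoupled t x (b : R) :
  (forall z, uncoupled t x z <= b) -> tv_dist P pi x t <= b.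
Proof.
move=> xb; rewrite /tv_dist ler_pdivrMl //.
apply: (@le_trans _ _ (\sum_y \sum_z
    pi z * `|step_pow P t x y - step_pow P t z y|)).
  apply: ler_sum => y _.
  have -> : step_pow P t x y - pi y =
      \sum_z pi z * (step_pow P t x y - step_pow P t z y).
    under eq_bigr do rewrite mulrBr.
    by rewrite sumrB -mulr_suml pi_sum mul1r step_pow_stationary.
  rewrite (le_trans (ler_norm_sum _ _ _)) //.
  by apply: ler_sum => z _; rewrite normrM ger0_norm.
rewrite exchange_big /= -[2 * b]mul1r -[X in _ <= X * _]pi_sum mulr_suml.
apply: ler_sum => z _; rewrite -mulr_sumr ler_wpM2l //.
by rewrite (le_trans (step_pow_dist _ _ _)) // ler_pM2l.
Qed.

(** The mixing time demands closeness at all later times as well; [uncoupled] is nonincreasing in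
    time. *)
Lemma mixing_time_le_uncoupled t (eps b : R) :
  (forall x z, uncoupled t x z <= eps) -> t%:R <= b ->
  (mixing_time P pi eps <= b%:E)%E.
Proof.
move=> t_eps tb; apply: bigmax_le => [|x _]; first exact: leNye.
apply: ge_ereal_inf; exists (t%:R)%:E; last by rewrite lee_fin.
exists t => // t' tt'; apply: tv_dist_le_uncoupled => z.
exact: le_trans (uncoupled_le_mono _ _ tt') (t_eps _ _).
Qed.

End RandomMaps.

(** * The hard-core model on a graph *)

Section Hamming.
Variable V : finType.
Implicit Types (I J K : {set V}).

Definition hdist I J : nat := \sum_w ((w \in I) (+) (w \in J)).

Lemma hdistC I J : hdist I J = hdist J I.
Proof. by apply: eq_bigr => w _; rewrite addbC. Qed.

Lemma hdist_refl I : hdist I I = 0%N.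
Proof. by apply: big1 => w _; rewrite addbb. Qed.

Lemma hdist_eq0 I J : hdist I J = 0%N -> I = J.
Proof.
move/eqP; rewrite sum_nat_eq0 => /forallP IJ; apply/setP => w.
by have := IJ w; case: (w \in I); case: (w \in J).
Qed.

Lemma hdist_triangle I J K : (hdist I K <= hdist I J + hdist J K)%N.
Proof.
rewrite -big_split; apply: leq_sum => w _.
by case: (w \in I); case: (w \in J); case: (w \in K).
Qed.

Lemma hdist_card I J : hdist I J = #|[pred w | (w \in I) (+) (w \in J)]|.
Proof.
rewrite -sum1_card [RHS]big_mkcond; apply: eq_bigr => w _.
by rewrite inE; case: (_ (+) _).
Qed.

(** Turns each case of a coupled move into a number: it suffices to list the sites where the copies
    may disagree. *)
Lemma hdist_le_size (D : seq V) I J :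
  (forall w, w \notin D -> (w \in I) = (w \in J)) -> (hdist I J <= size D)%N.
Proof.
move=> IJ; rewrite hdist_card (leq_trans _ (card_size D)) // subset_leq_card //.
apply/subsetP => w; rewrite inE; apply: contraLR => /IJ->.
by rewrite addbb.
Qed.

Lemma hdist_le_card I J : (hdist I J <= #|V|)%N.
Proof. by rewrite hdist_card max_card. Qed.

Lemma hdistD1 I J v : v \in I -> v \notin J -> hdist I J = (hdist (I :\ v) J).+1.
Proof.
move=> vI vJ; rewrite /hdist (bigD1 v) //= (bigD1 (P := xpredT) v) //=.
rewrite vI (negPf vJ) setD11 add0n add1n; congr _.+1.
by apply: eq_bigr => w wv; rewrite in_setD1 wv.
Qed.

Lemma hdist_delete I J v : (v \in I) (+) (v \in J) ->
  (hdist (I :\ v) (J :\ v)).+1 = hdist I J.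
Proof.
rewrite /hdist (bigD1 v) //= [in RHS](bigD1 v) //= => ->.
rewrite !setD11 add0n add1n; congr _.+1.
by apply: eq_bigr => w wv; rewrite !in_setD1 wv.
Qed.

End Hamming.

Lemma sum_option_bool (A : nmodType) (F : option bool -> A) :
  \sum_c F c = F None + F (Some true) + F (Some false).
Proof.
rewrite (bigD1 None) //= (bigD1 (Some true)) //= (bigD1 (Some false)) //=.
by rewrite big_pred0 ?addr0 ?addrA // => -[[]|].
Qed.

Section HardCore.
Variables (V : finType) (adj : rel V).
Hypothesis adj_sym : symmetric adj.
Hypothesis adj_irr : irreflexive adj.
Implicit Types (I J X Y : {set V}) (u v w : V).

Definition nbrs I v : {set V} := [set u in I | adj u v].

Definition independent I : bool := [forall u in I, [forall v in I, ~~ adj u v]].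

(* The seed (v, None) deletes v, (v, Some false) inserts v if it has no        *)
(* neighbour, and (v, Some true) also drags a unique neighbour onto v.         *)
Definition move (r : V * option bool) I : {set V} :=
  if r.2 is Some b then
    if (#|nbrs I r.1| <= b)%N then r.1 |: (I :\: nbrs I r.1) else I
  else I :\ r.1.

Lemma independentP I :
  reflect {in I &, forall u v, ~~ adj u v} (independent I).
Proof.
apply: (iffP forall_inP) => [H u v uI vI|H u uI].
  exact: (forall_inP (H u uI)).
by apply/forall_inP => v; apply: H.
Qed.

Lemma independentS I J : I \subset J -> independent J -> independent I.
Proof.
move=> /subsetP IJ /independentP Jind; apply/independentP => u v uI vI.
by apply: Jind; apply: IJ.
Qed.

Lemma nbrs_in I v : independent I -> v \in I -> nbrs I v = set0.
Proof.
move=> /independentP Iind vI; apply/setP => u; rewrite !inE.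
by apply/negP => /andP[uI]; apply/negP; apply: Iind.
Qed.

Lemma independentU1 I v : independent I -> nbrs I v = set0 -> independent (v |: I).
Proof.
move=> /independentP Iind /setP Iv; apply/independentP => u w.
have vfree x : x \in I -> ~~ adj x v.
  by move=> xI; have := Iv x; rewrite !inE xI /= => ->.
rewrite !inE => /orP[/eqP->|uI] /orP[/eqP->|wI]; first by rewrite adj_irr.
- by rewrite adj_sym vfree.
- by rewrite vfree.
- exact: Iind.
Qed.

Lemma move_independent r I : independent I -> independent (move r I).
Proof.
case: r => v [b|] Iind; rewrite /move /=; last exact: independentS (subD1set _ _) Iind.
case: ifP => // _; apply: independentU1; first exact: independentS (subsetDl _ _) Iind.
by apply/setP => u; rewrite !inE; case: (u \in I); case: (adj u v).
Qed.

(** Choosing the site of disagreement couples at once: by independence neither copy has a neighbour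
    of [v], so no move there is blocked. *)
Lemma hdist_move_same v b Y : independent (v |: Y) -> v \notin Y ->
  hdist (move (v, b) (v |: Y)) (move (v, b) Y) = 0%N.
Proof.
move=> Xind vY; suff -> : move (v, b) (v |: Y) = move (v, b) Y by apply: hdist_refl.
rewrite /move /=; case: b => [b|]; last first.
  by rewrite setU1K //; apply/esym/setDidPl; rewrite disjoint_sym disjoints1.
have Xv : nbrs (v |: Y) v = set0 by rewrite nbrs_in // setU11.
have Yv : nbrs Y v = set0.
  apply/eqP; rewrite -subset0 -Xv; apply/subsetP => u.
  by rewrite !inE => /andP[-> ->]; rewrite orbT.
by rewrite Xv Yv cards0 /= !setD0 setUA setUid.
Qed.

(** Both copies see the same neighbours of [w] and act alike, so only [v] can remain different. *)
Lemma hdist_move_far v w b Y : w != v -> ~~ adj v w ->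
  (hdist (move (w, b) (v |: Y)) (move (w, b) Y) <= 1)%N.
Proof.
move=> wv vw; apply: (@hdist_le_size _ [:: v]) => x; rewrite inE => xv.
have Nw : nbrs (v |: Y) w = nbrs Y w.
  apply/setP => u; rewrite !inE; case: (eqVneq u v) => [->|] //=.
  by rewrite (negPf vw) andbF.
rewrite /move /= Nw; case: b => [b|]; first case: ifP => _;
  by rewrite !inE (negPf xv).
Qed.

Lemma nbrsU1_adj v w Y : adj v w -> nbrs (v |: Y) w = v |: nbrs Y w.
Proof.
move=> vw; apply/setP => u; rewrite !inE; case: (eqVneq u v) => [->|] //=.
Qed.

(** * Path coupling for the insert/delete/drag chain *)

Section Weights.
Variables (R : realType) (a b : R).
Hypotheses (a_ge0 : 0 <= a) (b_ge0 : 0 <= b) (ab1 : a + 4 * b = 1).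

(** Insertion has total probability [4 * b] and dragging has [b]. Sharing one coin lets a drag in
    one copy coincide with an insertion in the other. *)
Definition coin_weight (c : option bool) : R :=
  if c is Some d then if d then b else 3 * b else a.

Definition seed_weight (r : V * option bool) : R := coin_weight r.2 / #|V|%:R.

Lemma coin_weight_ge0 c : 0 <= coin_weight c.
Proof. by case: c => [[]|] //=; rewrite mulr_ge0. Qed.

Lemma seed_weight_ge0 r : 0 <= seed_weight r.
Proof. by rewrite divr_ge0 ?coin_weight_ge0. Qed.

Lemma sum_coin_weight (F : option bool -> R) :
  \sum_c coin_weight c * F c = a * F None + b * F (Some true) + 3 * b * F (Some false).
Proof. exact: sum_option_bool. Qed.

Lemma sum_seed_weight (F : V * option bool -> R) :
  \sum_r seed_weight r * F r =
  (\sum_v \sum_c coin_weight c * F (v, c)) / #|V|%:R.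
Proof.
rewrite pair_bigA mulr_suml; apply: eq_bigr => -[v c] _ /=.
by rewrite /seed_weight /= mulrAC.
Qed.

(** Only a neighbour [w] of [v] can raise the expected distance. The two bad cases, no neighbour or
    one neighbour of [w] in [Y], both cost [a + 6 * b], which is [1 + 2 * b]. *)
Lemma site_drift v w Y : independent (v |: Y) -> v \notin Y ->
  \sum_c coin_weight c * (hdist (move (w, c) (v |: Y)) (move (w, c) Y))%:R
  <= (w != v)%:R + 2 * b * (adj v w)%:R.
Proof.
have [[a0 b0] ab] := (a_ge0, b_ge0, ab1).
move=> Xind vY; rewrite sum_coin_weight.
case: (eqVneq w v) => [->|wv].
  by rewrite adj_irr !hdist_move_same // !mulr0 !addr0.
pose H c := hdist (move (w, c) (v |: Y)) (move (w, c) Y).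
rewrite -/(H None) -/(H (Some true)) -/(H (Some false)).
have bnd (d0 d1 d2 : nat) (e : R) :
    (H None <= d0)%N -> (H (Some true) <= d1)%N -> (H (Some false) <= d2)%N ->
    a * d0%:R + b * d1%:R + 3 * b * d2%:R <= e ->
    a * (H None)%:R + b * (H (Some true))%:R + 3 * b * (H (Some false))%:R <= e.
  move=> h0 h1 h2; apply: le_trans; rewrite !lerD // ler_wpM2l ?ler_nat //.
  by rewrite mulr_ge0.
have [vw|vw] := boolP (adj v w); last first.
  by apply: (bnd 1 1 1)%N; rewrite ?hdist_move_far //=; lra.
have wX : w \notin v |: Y.
  apply/negP => wX; have /independentP /(_ v w) := Xind.
  by rewrite setU11 vw wX => /(_ isT isT).
have H0 : (H None <= 1)%N.
  apply: (@hdist_le_size _ [:: v]) => x; rewrite !inE => xv.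
  by rewrite /move /= ?inE (negPf xv).
have vNY : v \notin nbrs Y w by rewrite inE (negPf vY).
have NX : nbrs (v |: Y) w = v |: nbrs Y w by exact: nbrsU1_adj.
have cX : #|nbrs (v |: Y) w| = #|nbrs Y w|.+1 by rewrite NX cardsU1 vNY.
case cY : #|nbrs Y w| cX => [|[|k]] cX.
(* [w] is free in [Y] and blocked only by [v] in the other copy: the dragging coin merges the
   copies, the plain insertion coin acts on [Y] alone. *)
- apply: (bnd 1 0 2)%N => //; last by rewrite /=; lra.
    move: (cards0_eq cY) => NY; apply: (@hdist_le_size _ [::]) => x _.
    rewrite /move /= cX cY /= NX NY setU0 !inE.
    by case: (eqVneq x v) => [->|] //=; rewrite (negPf vY) ?andbF.
  apply: (@hdist_le_size _ [:: v; w]) => x; rewrite !inE negb_or => /andP[xv xw].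
  by rewrite /move /= cX cY /= (cards0_eq cY) !inE (negPf xv) (negPf xw).
(* [Y] can drag its unique neighbour [u] onto [w], while the other copy is blocked by [u] and [v]:
   disagreement at [v], [u] and [w]. *)
- apply: (bnd 1 3 1)%N => //; last by rewrite /=; lra.
    have /eqP/cards1P[u NY] := cY.
    apply: (@hdist_le_size _ [:: v; u; w]) => x; rewrite !inE !negb_or => /and3P[xv xu xw].
    by rewrite /move /= cX cY /= NY !inE (negPf xv) (negPf xw) (negPf xu).
  apply: (@hdist_le_size _ [:: v]) => x; rewrite !inE => xv.
  by rewrite /move /= cX cY /= !inE (negPf xv).
(* With two or more neighbours in [Y], [w] is blocked in both copies. *)
- apply: (bnd 1 1 1)%N => //; last by rewrite /=; lra.
    apply: (@hdist_le_size _ [:: v]) => x; rewrite !inE => xv.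
    by rewrite /move /= cX cY /= !inE (negPf xv).
  apply: (@hdist_le_size _ [:: v]) => x; rewrite !inE => xv.
  by rewrite /move /= cX cY /= !inE (negPf xv).
Qed.

Variable Delta : nat.
Hypothesis deg_le : forall v, (#|[set w | adj v w]| <= Delta)%N.

Lemma hdist_contract1 v Y : independent (v |: Y) -> v \notin Y ->
  \sum_r seed_weight r * (hdist (move r (v |: Y)) (move r Y))%:R
  <= 1 - (1 - 2 * b * Delta%:R) / #|V|%:R.
Proof.
move=> Xind vY; rewrite sum_seed_weight.
have V0 : 0 < #|V|%:R :> R by rewrite ltr0n; apply/card_gt0P; exists v.
rewrite ler_pdivrMr // mulrBl mul1r divfK ?gt_eqF //.
apply: le_trans (ler_sum _ (fun w _ => site_drift w Xind vY)) _.
rewrite big_split /= -mulr_sumr -!natr_sum.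
have -> : (\sum_(w : V) (w != v) = #|V|.-1)%N.
  rewrite -(cardC1 v) -sum1_card [RHS]big_mkcond; apply: eq_bigr => w _.
  by rewrite !inE; case: (w == v).
have -> : (\sum_(w : V) adj v w = #|[set w | adj v w]|)%N.
  by rewrite -sum1_card [RHS]big_mkcond; apply: eq_bigr => w _; rewrite inE; case: (adj v w).
have := deg_le v; rewrite -(ler_nat R) => degv.
have Vpred : #|V|%:R = #|V|.-1%:R + 1 :> R.
  by rewrite natr1 prednK // -(ltr0n R).
have : 2 * b * #|[set w | adj v w]|%:R <= 2 * b * Delta%:R by rewrite ler_wpM2l ?mulr_ge0.
rewrite Vpred; lra.
Qed.

(** Path coupling: elements outside the other set are removed one at a time, from either side. The
    path descends to the intersection, so it stays among independent sets. *)
Lemma hdist_contract I J : independent I -> independent J ->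
  \sum_r seed_weight r * (hdist (move r I) (move r J))%:R
  <= (1 - (1 - 2 * b * Delta%:R) / #|V|%:R) * (hdist I J)%:R.
Proof.
have [k dk] := ubnP (hdist I J); elim: k I J dk => // k IHk I J dk Iind Jind.
have [IJ|IJ] := eqVneq I J.
  by rewrite IJ hdist_refl mulr0 big1 // => r _; rewrite hdist_refl mulr0.
wlog [v vI vJ] : I J dk Iind Jind IJ / exists2 v, v \in I & v \notin J.
  move=> wl; have [/subsetPn[v vI vJ]|] := boolP (~~ (I \subset J)).
    by apply: wl => //; exists v.
  rewrite negbK => sIJ; have [/subsetPn[v vI vJ]|] := boolP (~~ (J \subset I)).
    rewrite hdistC; under eq_bigr do rewrite hdistC.
    by apply: wl => //; [rewrite hdistC | rewrite eq_sym | exists v].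
  by rewrite negbK => sJI; rewrite eqEsubset sIJ sJI in IJ.
have dE := hdistD1 vI vJ; rewrite dE in dk *.
have I'ind : independent (I :\ v) by apply: independentS (subD1set _ _) Iind.
have IE : v |: (I :\ v) = I by rewrite setD1K.
have c1 := @hdist_contract1 v (I :\ v).
rewrite IE setD11 in c1; have {}c1 := c1 Iind isT.
have c2 := IHk _ _ dk I'ind Jind.
apply: (@le_trans _ _ (\sum_r seed_weight r * (hdist (move r I) (move r (I :\ v)))%:R
   + \sum_r seed_weight r * (hdist (move r (I :\ v)) (move r J))%:R)).
  rewrite -big_split; apply: ler_sum => r _ /=; rewrite -mulrDr -natrD.
  by rewrite ler_wpM2l ?seed_weight_ge0 // ler_nat hdist_triangle.
by rewrite -[X in _ <= _ * X]natr1 mulrDr mulr1 addrC lerD.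
Qed.

End Weights.
End HardCore.

(** * Exponential supersolution at criticality *)

Section ExpDrift.
Variables (V : finType) (adj : rel V).
Hypothesis adj_irr : irreflexive adj.
Variables (R : realType) (a b : R) (Delta : nat).
Hypotheses (a_ge0 : 0 <= a) (b_ge0 : 0 <= b) (ab1 : a + 4 * b = 1).
Hypothesis deg_le : forall v, (#|[set w | adj v w]| <= Delta)%N.
Hypothesis subcritical : 2 * b * Delta%:R <= 1.
Hypothesis V_gt0 : (0 < #|V|)%N.
Implicit Types (I J : {set V}).

Let N_gt0 : 0 < #|V|%:R :> R. Proof. by rewrite ltr0n. Qed.

Lemma sum_seed_weight1 : \sum_(r : V * option bool) seed_weight a b r = 1.
Proof.
rewrite -[LHS](eq_bigr _ (fun r _ => mulr1 _)) sum_seed_weight.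
under eq_bigr do rewrite sum_coin_weight !mulr1.
rewrite sumr_const [a + b + _](_ : _ = 1); last by have := ab1; lra.
by rewrite divff // gt_eqF.
Qed.

(* Deleting at a site where I and J differ always brings them one step closer; *)
(* this is the only fluctuation that is needed.                                *)
Lemma expR_hdist_drift I J (theta : R) :
  independent adj I -> independent adj J -> 0 <= theta ->
  expR (- (theta * (hdist I J)%:R)) *
    (1 + a / 4 * theta ^+ 2 * ((hdist I J)%:R / #|V|%:R))
  <= \sum_r seed_weight a b r *
       expR (- (theta * (hdist (move adj r I) (move adj r J))%:R)).
Proof.
move=> Iind Jind theta0; set d : R := (hdist I J)%:R.
pose h r : R := (hdist (move adj r I) (move adj r J))%:R.
pose near_end (r : V * option bool) := (r.2 == None) && ((r.1 \in I) (+) (r.1 \in J)).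
have step r : 1 + theta * (d - h r) + theta ^+ 2 / 4 * (near_end r)%:R
    <= expR (theta * (d - h r)).
  case: r => v c; rewrite /near_end /h /=.
  case: eqP => [->|_] /=; last by rewrite mulr0 addr0 expR_ge1Dx.
  case vIJ: (_ (+) _); last by rewrite mulr0 addr0 expR_ge1Dx.
  rewrite /d -(hdist_delete vIJ) /move /=; set x := hdist _ _.
  have -> : x.+1%:R - x%:R = 1 :> R by rewrite -natr1 addrAC subrr add0r.
  rewrite !mulr1.
  (* Squaring [1 + theta / 2 <= expR (theta / 2)] keeps a quadratic term, which [expR_ge1Dx] alone
     would lose. *)
  have -> : expR theta = expR (theta / 2) * expR (theta / 2).
    by rewrite -expRD; congr expR; lra.
  have e1 := expR_ge1Dx (theta / 2).
  have e0 : 0 <= 1 + theta / 2 by lra.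
  have := ler_pM e0 e0 e1 e1; apply: le_trans.
  by rewrite le_eqVlt; apply/orP; left; apply/eqP; field.
rewrite [leRHS](_ : _ = expR (- (theta * d)) *
    \sum_r seed_weight a b r * expR (theta * (d - h r))); last first.
  rewrite mulr_sumr; apply: eq_bigr => r _; rewrite mulrCA -expRD.
  by congr (_ * expR _); rewrite -/(h r); ring.
rewrite ler_wpM2l ?expR_ge0 //.
apply: (@le_trans _ _ (\sum_r seed_weight a b r *
    (1 + theta * (d - h r) + theta ^+ 2 / 4 * (near_end r)%:R))); last first.
  by apply: ler_sum => r _; rewrite ler_wpM2l ?seed_weight_ge0.
have -> : \sum_r seed_weight a b r *
    (1 + theta * (d - h r) + theta ^+ 2 / 4 * (near_end r)%:R) =
    (1 + theta * d) * (\sum_(r : V * option bool) seed_weight a b r)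
    - theta * (\sum_r seed_weight a b r * h r)
    + theta ^+ 2 / 4 * (\sum_r seed_weight a b r * (near_end r)%:R).
  rewrite !mulr_sumr -sumrB -big_split; apply: eq_bigr => r _ /=; ring.
rewrite sum_seed_weight1 mulr1.
have -> : \sum_r seed_weight a b r * (near_end r)%:R = a * (d / #|V|%:R).
  rewrite sum_seed_weight mulrA; congr (_ / _); rewrite /d /hdist natr_sum mulr_sumr.
  by apply: eq_bigr => v _; rewrite sum_coin_weight /near_end /= !mulr0 !addr0.
(* The distance is a supermartingale, so the terms linear in [theta] contribute a nonnegative
   amount. *)
have drift : \sum_r seed_weight a b r * h r <= d.
  rewrite (le_trans (hdist_contract adj_irr a_ge0 b_ge0 ab1 deg_le Iind Jind)) //.
  rewrite ler_piMl ?ler0n // gerBl divr_ge0 ?ler0n // subr_ge0.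
  exact: subcritical.
have := ler_wpM2l theta0 drift.
have -> : a / 4 * theta ^+ 2 * (d / #|V|%:R) = theta ^+ 2 / 4 * (a * (d / #|V|%:R)) by ring.
lra.
Qed.

Lemma expR_le_1D2x (y : R) : 0 <= y <= 2^-1 -> expR y <= 1 + 2 * y.
Proof.
move=> /andP[y0 y1]; have e := expR_ge1Dx (- y).
rewrite -[y in expR y]opprK expRN -[leRHS]invrK lef_pV2 ?posrE ?invr_gt0 ?expR_gt0 //; last by lra.
apply: le_trans e; rewrite -[leLHS]mul1r ler_pdivrMr; last by lra.
nra.
Qed.

(** A discrete form of the solution of theta' = - k theta^2 with theta(0) = 1. The constant k is
    half the [a / (4 * #|V|)] of the drift bound, leaving room for the factor 2 in
    [expR_le_1D2x]. *)
Definition rate (s : nat) : R := (1 + a / (8 * #|V|%:R) * s%:R)^-1.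

(** Lowering the exponent from [rate s] to [rate s.+1] costs a factor at most [expR y], hence at
    most [1 + 2 * y], and [2 * y] is exactly the quadratic gain of [expR_hdist_drift]. *)
Lemma hdist_supersolution I J s : independent adj I -> independent adj J ->
  \sum_r seed_weight a b r *
    (1 - expR (- (rate s * (hdist (move adj r I) (move adj r J))%:R)))
  <= 1 - expR (- (rate s.+1 * (hdist I J)%:R)).
Proof.
move=> Iind Jind; set d : R := (hdist I J)%:R.
pose k : R := a / (8 * #|V|%:R).
have k0 : 0 <= k by rewrite divr_ge0 // mulr_ge0.
have ks : 0 <= k * s%:R by rewrite mulr_ge0.
have r0 : 0 < rate s by rewrite invr_gt0 -/k; lra.
have r1 : rate s <= 1 by rewrite invf_le1 -/k; lra.
have rS : rate s - rate s.+1 <= k * rate s ^+ 2.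
  rewrite /rate -/k -natr1; set t : R := s%:R in ks *.
  have -> : (1 + k * t)^-1 - (1 + k * (t + 1))^-1 =
      k * ((1 + k * t)^-1 * (1 + k * (t + 1))^-1).
    by field; apply/andP; split; rewrite gt_eqF //; lra.
  rewrite ler_wpM2l // expr2; apply: ler_wpM2l; first by rewrite invr_ge0; lra.
  by rewrite lef_pV2 ?posrE; lra.
under eq_bigr do rewrite mulrBr mulr1.
rewrite sumrB sum_seed_weight1 lerD2l lerN2.
apply: le_trans (expR_hdist_drift Iind Jind (ltW r0)); rewrite -/d.
have d0 : 0 <= d by [].
have dN : d <= #|V|%:R by rewrite ler_nat hdist_le_card.
have -> : expR (- (rate s.+1 * d)) = expR (- (rate s * d)) * expR ((rate s - rate s.+1) * d).
  by rewrite -expRD; congr expR; ring.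
rewrite ler_wpM2l ?expR_ge0 //.
(* The distance is at most [#|V|] and [a] is at most 1; this puts [y] in the range of
   [expR_le_1D2x]. *)
have kd : k * d <= 2^-1.
  rewrite /k mulrAC ler_pdivrMr ?mulr_gt0 //.
  have := ler_pM a_ge0 d0 (_ : a <= 1) dN; have := b_ge0; have := ab1; lra.
set y := k * rate s ^+ 2 * d.
have yh : 0 <= y <= 2^-1.
  apply/andP; split; first by rewrite !mulr_ge0 // ltW.
  apply: le_trans kd; rewrite ler_wpM2r // ler_piMr // exprn_ile1 //.
  exact: ltW.
apply: (@le_trans _ _ (expR y)); first by rewrite ler_expR ler_wpM2r.
apply: le_trans (expR_le_1D2x yh) _.
by rewrite le_eqVlt; apply/orP; left; apply/eqP; rewrite /y /k; field; rewrite gt_eqF.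
Qed.

End ExpDrift.

(** * Reversibility of the hard-core chain *)

Section DetailedBalance.
Variables (V : finType) (adj : rel V).
Hypothesis adj_sym : symmetric adj.
Hypothesis adj_irr : irreflexive adj.
Implicit Types (I J : {set V}) (u v w : V).

Definition is_insert I J v : bool := (nbrs adj I v == set0) && (v |: I == J).

Definition is_drag I J v u : bool :=
  (nbrs adj I v == [set u]) && (v |: (I :\ u) == J).

(** Inserting an element already in [J] changes nothing; [I != J] excludes this degenerate
    insertion. *)
Lemma is_insert_delete I J v : independent adj I -> I != J ->
  is_insert J I v = (I :\ v == J).
Proof.
move=> Iind IJ; apply/andP/eqP => [[_ /eqP vJ]|vJ].
  by rewrite -vJ setU1K //; apply: contraNN IJ => vJ'; rewrite -vJ (setUidPr _) ?sub1set.
have vI : v \in I by apply: contraNT IJ => vI; rewrite -vJ (setDidPl _) // disjoint_sym disjoints1.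
split; last by rewrite -vJ setD1K.
rewrite -subset0 -(nbrs_in Iind vI); apply/subsetP => u.
by rewrite -vJ !inE => /andP[/andP[_ ->] ->].
Qed.

(** The reverse drag is legal: by independence no other element of [I] is adjacent to [u], so [v] is
    its only neighbour in [J]. *)
Lemma is_drag_imp I J v u : independent adj I -> is_drag I J v u ->
  is_drag J I u v /\ #|I| = #|J|.
Proof.
move=> Iind /andP[/eqP Iv /eqP <-].
have : u \in nbrs adj I v by rewrite Iv set11.
rewrite inE => /andP[uI uv].
have vI : v \notin I.
  by apply/negP => vI; have := set11 u; rewrite -Iv (nbrs_in Iind vI) inE.
have vIu : v \notin I :\ u by rewrite inE (negPf vI) andbF.
split; last by rewrite cardsU1 vIu (cardsD1 u I) uI.
rewrite /is_drag setU1K // setD1K // eqxx andbT; apply/eqP/setP => x; rewrite !inE.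
case: (eqVneq x v) => [->|xv] /=; first by rewrite adj_sym uv.
apply/negP => /andP[/andP[xu xI]].
by apply/negP; move/independentP: Iind; apply.
Qed.

Lemma is_dragC I J v u : independent adj I -> independent adj J ->
  is_drag I J v u = is_drag J I u v.
Proof.
by move=> Iind Jind; apply/idP/idP => /is_drag_imp []// .
Qed.

Variables (R : realType) (a b lambda : R).
Hypothesis a_lambda : a * lambda = 4 * b.

(** Transitions between distinct sets split into deletions, insertions and drags. Deletions pair
    with insertions through [a * lambda = 4 * b]; drags preserve cardinality and pair with their
    reversals. *)
Lemma move_reversible I J : independent adj I -> independent adj J ->
  lambda ^+ #|I| * \sum_r seed_weight a b r * (move adj r I == J)%:R =
  lambda ^+ #|J| * \sum_r seed_weight a b r * (move adj r J == I)%:R.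
Proof.
move=> Iind Jind; have [->//|IJ] := eqVneq I J.
have split_sum K L : independent adj K -> independent adj L -> K != L ->
    \sum_v \sum_c coin_weight a b c * (move adj (v, c) K == L)%:R =
    \sum_v (a * (is_insert L K v)%:R + 4 * b * (is_insert K L v)%:R)
    + b * \sum_v \sum_u (is_drag K L v u)%:R.
  move=> Kind Lind KL; rewrite mulr_sumr -big_split; apply: eq_bigr => v _ /=.
  rewrite sum_coin_weight (is_insert_delete _ Kind KL) {1}/move /=.
  rewrite /is_insert /is_drag /move /= -[nbrs adj K v == set0]cards_eq0.
  case cK: #|nbrs adj K v| => [|[|k]] /=.
  - rewrite (cards0_eq cK) setD0 /= big1 ?mulr0 ?addr0; last first.
      by move=> u _; rewrite [set0 == _]eq_sym -cards_eq0 cards1.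
    ring.
  - have /eqP/cards1P[u Ku] := cK; rewrite Ku (bigD1 u) //= eqxx /= big1.
      by rewrite (negPf KL) /= !mulr0 !addr0.
    by move=> w wu; rewrite (inj_eq set1_inj) eq_sym (negPf wu).
  - rewrite (negPf KL) /= big1 ?mulr0 ?addr0 //.
    by move=> u _; case: eqP => // Ku; rewrite Ku cards1 in cK.
rewrite !sum_seed_weight !mulrA; congr (_ / _).
rewrite !split_sum //; last by rewrite eq_sym.
rewrite !mulrDr; congr (_ + _).
  rewrite !mulr_sumr; apply: eq_bigr => v _.
  have ins K L : is_insert K L v -> K != L ->
      lambda ^+ #|L| * a = lambda ^+ #|K| * (4 * b).
    move=> /andP[_ /eqP<-] KL; rewrite cardsU1.
    case: (boolP (v \in K)) KL => [vK|vK _]; first by rewrite (setUidPr _) ?sub1set // eqxx.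
    by rewrite exprD expr1 -a_lambda; ring.
  rewrite !mulrDr addrC !mulrA; congr (_ + _).
    case ijv: (is_insert I J v); rewrite ?mulr0 // -!mulrA (mulrA _ a) (ins _ _ ijv) //.
    by rewrite !mulr1 mulrA.
  by case ijv: (is_insert J I v); rewrite ?mulr0 // !mulr1 (ins _ _ ijv) 1?eq_sym // mulrA.
rewrite exchange_big /= !(mulrCA _ b); congr (_ * _); rewrite !mulr_sumr.
apply: eq_bigr => v _; rewrite !mulr_sumr; apply: eq_bigr => u _.
rewrite (is_dragC _ _ Iind Jind).
by case ijv: (is_drag J I v u); rewrite ?mulr0 // (is_drag_imp Jind ijv).2.
Qed.

End DetailedBalance.

(** * Tilings as independent sets *)

Section Tilings.
Variable n : nat.
Implicit Types (u v w c : site n) (I : {set site n}) (X : {set tile n}).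

Lemma nearC : symmetric (@near n).
Proof. by move=> i j; rewrite /near eq_sym; congr orb; rewrite orbC. Qed.

Lemma near_refl : reflexive (@near n).
Proof. by move=> i; rewrite /near eqxx. Qed.

Lemma adjacentC : symmetric (@adjacent n).
Proof. by move=> u v; rewrite /adjacent eq_sym nearC [near u.2 _]nearC. Qed.

Lemma adjacentxx : irreflexive (@adjacent n).
Proof. by move=> u; rewrite /adjacent eqxx. Qed.

Lemma nearP (i j : 'I_n) :
  reflect (exists k, (k \in [:: i; ordS i]) && (k \in [:: j; ordS j])) (near i j).
Proof.
apply: (iffP idP) => [/or3P[] /eqP ij|[k]].
- by exists i; rewrite ij !inE eqxx.
- by exists j; rewrite -ij !inE eqxx orbT.
- by exists i; rewrite -ij !inE eqxx orbT.
- rewrite !inE => /andP[/orP[] /eqP-> /orP[] /eqP ij].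
  + by rewrite ij near_refl.
  + by rewrite ij /near eqxx !orbT.
  + by rewrite -ij /near eqxx !orbT.
  + by rewrite (can_inj (@ordSK n) ij) near_refl.
Qed.

Lemma mem_block v c :
  (c \in block v) = (c.1 \in [:: v.1; ordS v.1]) && (c.2 \in [:: v.2; ordS v.2]).
Proof.
case: c v => i j [k l]; rewrite !inE !xpair_eqE /=.
by do 4 case: (_ == _).
Qed.

(** King's-graph adjacency is overlap of distinct blocks, which is why disjoint 2 x 2 squares form
    an independent set. *)
Lemma adjacentP u v :
  reflect (u != v /\ exists2 c, c \in block u & c \in block v) (adjacent u v).
Proof.
apply: (iffP and3P) => [[uv /nearP[i /andP[iu iv]] /nearP[j /andP[ju jv]]]|].
  by split=> //; exists (i, j); rewrite mem_block /= ?iu ?iv.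
move=> [uv [[i j]]]; rewrite !mem_block /= => /andP[iu ju] /andP[iv jv].
by split=> //; apply/nearP; [exists i; rewrite iu | exists j; rewrite ju].
Qed.

(** The neighbours lie in a 3 x 3 list with one occurrence of [v] removed; repetitions on a small
    torus only lower the count. *)
Lemma adjacent_degree v : (#|[set w | adjacent v w]| <= 8)%N.
Proof.
pose near_seq (i : 'I_n) := [:: i; ordS i; ord_pred i].
have near_mem (i j : 'I_n) : near i j -> j \in near_seq i.
  rewrite !inE => /or3P[] /eqP <-; rewrite ?eqxx ?orbT //.
  by rewrite ordSK eqxx !orbT.
have -> : 8%N = (size [seq (i, j) | i <- near_seq v.1, j <- near_seq v.2]).-1 by [].
have vin : v \in [seq (i, j) | i <- near_seq v.1, j <- near_seq v.2].
  by case: v => i j; apply/allpairsP; exists (i, j); rewrite !inE !eqxx.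
rewrite -(size_rem vin); apply: leq_trans (card_size _); apply: subset_leq_card.
apply/subsetP => w; rewrite inE => /and3P[vw w1 w2].
have : w \in [seq (i, j) | i <- near_seq v.1, j <- near_seq v.2].
  by case: w w1 w2 {vw} => i j /= /near_mem w1 /near_mem w2; exact: (allpairs_f pair w1 w2).
rewrite (perm_mem (perm_to_rem vin)) inE => /orP[/eqP wv|//].
by rewrite wv eqxx in vw.
Qed.

Lemma uniq_block v : (1 < n)%N -> uniq (block v).
Proof.
move=> n1; have ordS_neq (i : 'I_n) : (ordS i == i) = false.
  apply/negbTE/eqP => /(congr1 val) /= iE; have := ltn_ord i.
  rewrite leq_eqVlt => /orP[/eqP iN|iN]; last first.
    by rewrite modn_small // in iE; move/eqP: iE; rewrite -[X in _ == X]addn0 -addn1 eqn_add2l.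
  by rewrite iN modnn in iE; rewrite -iE in iN; rewrite -iN in n1.
case: v => i j; rewrite /block /= !inE !xpair_eqE (eq_sym i) (eq_sym j) !ordS_neq.
by rewrite !andbF.
Qed.

Definition bigs X : {set site n} := [set v | big v \in X].

Definition tiles I : {set tile n} :=
  [set t | if t.1 then t.2 \in I else [forall u in I, t.2 \notin block u]].

(** Distinct squares do not overlap, and no square wraps onto itself; the second condition matters
    on the 1 x 1 torus. *)
Definition packing I : bool :=
  independent (@adjacent n) I && [forall v in I, uniq (block v)].

Lemma packing_disjoint I u v c : packing I -> u \in I -> v \in I ->
  c \in block u -> c \in block v -> u = v.
Proof.
move=> /andP[/independentP Iind _] uI vI cu cv; apply/eqP/negPn/negP => uv.
by have /adjacentP[] := Iind _ _ uI vI; split=> //; exists c.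
Qed.

Lemma big_tiles I v : (big v \in tiles I) = (v \in I).
Proof. by rewrite inE. Qed.

Lemma small_tilesP I c :
  reflect (forall u, u \in I -> c \notin block u) (small c \in tiles I).
Proof. by rewrite inE; apply: (iffP forall_inP). Qed.

Lemma bigs_tiles I : bigs (tiles I) = I.
Proof. by apply/setP => v; rewrite !inE. Qed.

Lemma nb_bigE X : nb_big X = #|bigs X|.
Proof.
rewrite -(card_imset (mem (bigs X)) (f := @big n)); last by move=> u v [].
apply: eq_card => -[[] v]; rewrite !inE /= ?andbT ?andbF.
  by apply/idP/imsetP => [vX|[u + [->]]]; rewrite ?inE //; exists v; rewrite ?inE.
by apply/esym/imsetP => -[].
Qed.

Lemma tiles_tiling I : packing I -> is_tiling (tiles I).
Proof.
move=> Ipack; have /andP[_ /forall_inP Iuniq] := Ipack.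
apply/forallP => c; have [cI|] := boolP (small c \in tiles I).
  rewrite (bigD1 (small c)) //= eqxx big1 // => -[[] v]; last first.
    rewrite /small xpair_eqE /= => /andP[_ vc].
    by rewrite /cells /= addn0 (negPf vc).
  rewrite -/(big v) big_tiles => /andP[vI _]; apply/count_memPn.
  by move/small_tilesP: cI; apply.
rewrite inE negb_forall_in => /exists_inP[u uI]; rewrite negbK => cu.
rewrite (bigD1 (big u)) ?big_tiles // -[cells (big u)]/(block u) count_uniq_mem ?Iuniq // cu.
rewrite big1 // => -[[] v].
  rewrite -/(big v) big_tiles {2}/big xpair_eqE => /andP[vI vu]; apply/count_memPn.
  by apply: contraNN vu => cv; rewrite (packing_disjoint Ipack vI uI cv cu) !eqxx.
rewrite -/(small v) => /andP[vI _]; apply/count_memPn; rewrite inE.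
by apply/negP => /eqP cv; move/small_tilesP: vI => /(_ _ uI); rewrite -(cv : c = v) cu.
Qed.

Lemma tiling_packing X : is_tiling X -> packing (bigs X) /\ X = tiles (bigs X).
Proof.
move=> /forallP Xcov.
(* Two different tiles containing [c] would bring its multiplicity to at least 2. *)
have uniq_cover c s t : s \in X -> t \in X -> c \in cells s -> c \in cells t -> s = t.
  move=> sX tX cs ct; apply/eqP; have := Xcov c.
  rewrite (bigD1 s) //=; apply: contraTT => st.
  rewrite (bigD1 t) /=; last by rewrite tX eq_sym.
  move: cs ct; rewrite -!has_pred1 !has_count.
  by case: count => // k _; case: count => // l _; rewrite !addSn addnS.
split; last first.
  apply/setP => -[[] v]; first by rewrite -/(big v) big_tiles inE.
  rewrite -/(small v); apply/idP/small_tilesP => [vX u|vI].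
    rewrite inE => uX; apply/negP => vu.
    by have := uniq_cover v _ _ vX uX (mem_head _ _) vu.
  have := Xcov v; apply: contraTT => vX; rewrite big1 // => -[[] w] tX; apply/count_memPn.
    by apply: vI; rewrite inE.
  by rewrite inE; apply: contraNN vX => /eqP->.
apply/andP; split.
  apply/independentP => u v; rewrite !inE => uX vX; apply/negP.
  move=> /adjacentP[/eqP uv [c cu cv]]; apply: uv.
  by case: (uniq_cover c _ _ uX vX cu cv).
apply/forall_inP => v; rewrite inE => vX; apply: count_mem_uniq => c.
have [cv|/count_memPn//] := boolP (c \in block v).
have : (count_mem c (block v) <= 1)%N.
  by rewrite -(eqP (Xcov c)) (bigD1 (big v)) //; apply: leq_addr.
by move: cv; rewrite -has_pred1 has_count; case: count => // -[|k].
Qed.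

Lemma four_smalls_tiles I v : packing I ->
  four_smalls (tiles I) v =
  [&& uniq (block v), v \notin I & nbrs (@adjacent n) I v == set0].
Proof.
move=> Ipack; rewrite /four_smalls; case: (uniq _) => //=.
apply/subsetP/andP => [vX|[vI /eqP Iv] t].
  have cX c u : u \in I -> c \in block v -> c \notin block u.
    move=> uI cv; have /small_tilesP : small c \in tiles I.
      by apply: vX; apply: imset_f.
    exact.
  split; first by apply/negP => vI; have := cX v v vI (mem_head _ _); rewrite mem_head.
  apply/eqP/setP => u; rewrite !inE; apply/negP => /andP[uI /adjacentP[_ [c cu cv]]].
  by have := cX c u uI cv; rewrite cu.
move=> /imsetP[c cv ->]; apply/small_tilesP => u uI; apply/negP => cu.
have /setP/(_ u) := Iv; rewrite !inE uI /= => /negP; apply; apply/adjacentP.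
split; first by apply: contraNneq vI => <-.
by exists c.
Qed.

Lemma put_big_tiles I v : put_big (tiles I) v = tiles (v |: I).
Proof.
apply/setP => -[[] u].
  rewrite -/(big u) big_tiles in_setU1 in_setD in_setU1 big_tiles /big xpair_eqE /=.
  case: (u == v) => //=; rewrite andbC; case: (u \in I) => //=.
  by apply/imsetP => -[].
rewrite -/(small u) in_setU1 in_setD /=.
have -> : (small u \in smalls v) = (u \in block v).
  by apply/imsetP/idP => [[c cv [->]]//|uv]; exists u.
apply/andP/small_tilesP => [[uv /small_tilesP uI] w|uI].
  by rewrite in_setU1 => /orP[/eqP->//|]; apply: uI.
split; first by apply: uI; rewrite setU11.
by apply/small_tilesP => w wI; apply: uI; rewrite in_setU1 wI orbT.
Qed.

Lemma put_smalls_tiles I v : packing I ->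
  (v \in I) || (nbrs (@adjacent n) I v == set0) ->
  put_smalls (tiles I) v = tiles (I :\ v).
Proof.
move=> Ipack free; have sep w c : w \in I -> w != v -> c \in block w -> c \notin block v.
  move=> wI wv cw; apply/negP => cv; case/orP: free => [vI|/eqP/setP/(_ w)].
    by rewrite (packing_disjoint Ipack wI vI cw cv) eqxx in wv.
  rewrite !inE wI /= => /negP; apply; apply/adjacentP; split=> //; by exists c.
apply/setP => -[[] u].
  rewrite -/(big u) big_tiles in_setU 2!in_setD1 big_tiles /big xpair_eqE /=.
  case: (_ && _) => //=; by apply/imsetP => -[].
rewrite -/(small u) in_setU in_setD1 /=.
have -> : (small u \in smalls v) = (u \in block v).
  by apply/imsetP/idP => [[c cv [->]]//|uv]; exists u.
apply/orP/small_tilesP => [[/small_tilesP uI|uv] w|uI].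
- by rewrite in_setD1 => /andP[_]; apply: uI.
- by rewrite in_setD1 => /andP[wv wI]; apply: contraTN uv; apply: sep.
- have [uv|uv] := boolP (u \in block v); [by right|left].
  apply/small_tilesP => w wI; case: (eqVneq w v) => [->//|wv].
  by apply: uI; rewrite in_setD1 wv.
Qed.

(** A second square meeting the block of [v] would cover one of its cells outside the block of [u],
    where a unit square is required. So at most one [u] is draggable, and the [pick] in the chain is
    unambiguous. *)
Lemma drag_ok_tiles I v u : packing I -> v \notin I ->
  drag_ok (tiles I) v u = (nbrs (@adjacent n) I v == [set u]).
Proof.
move=> Ipack vI; rewrite /drag_ok /has_big big_tiles.
apply/and3P/eqP => [[uI uv /allP vX]|Iv].
  apply/setP => w; rewrite !inE; case: (eqVneq w u) => [->|wu]; first by rewrite uI uv.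
  apply/negP => /andP[wI /adjacentP[wv [c cw cv]]].
  have /orP[cu|/small_tilesP/(_ w wI)] := vX c cv; last by rewrite cw.
  by rewrite (packing_disjoint Ipack wI uI cw cu) eqxx in wu.
have : u \in nbrs (@adjacent n) I v by rewrite Iv set11.
rewrite inE => /andP[uI uv]; split=> //; apply/allP => c cv.
have [//|cu] := boolP (c \in block u); apply/small_tilesP => w wI.
apply/negP => cw; have : w \in nbrs (@adjacent n) I v.
  rewrite inE wI; apply/adjacentP; split; last by exists c.
  by apply: contraNneq vI => <-.
by rewrite Iv inE => /eqP wu; rewrite -wu cw in cu.
Qed.

(** The chain as a random map: at a central flip both insertion coins put the 2 x 2 square, while
    only [Some true] performs a drag. *)
Definition tile_move (r : site n * option bool) X : {set tile n} :=
  let v := r.1 in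
  if central_ok X v then if r.2 is None then put_smalls X v else put_big X v
  else if r.2 is Some true then
    if [pick u | drag_ok X v u] is Some u then drag X v u else X
  else X.

(** The cases [v] occupied, [v] free and [v] blocked match the branches of the chain: a central flip
    in the first two, a drag or nothing in the third. *)
Lemma tile_move_tiles I r : (1 < n)%N -> packing I ->
  tile_move r (tiles I) = tiles (move (@adjacent n) r I).
Proof.
move=> n1 Ipack; have /andP[Iind _] := Ipack; case: r => v c.
rewrite /tile_move /central_ok /has_big big_tiles four_smalls_tiles // uniq_block //=.
have [vI|vI] /= := boolP (v \in I).
  have Iv := nbrs_in Iind vI; rewrite /move /= Iv cards0 setD0.
  case: c => [b|] /=; first by rewrite put_big_tiles.
  by rewrite put_smalls_tiles // vI.
have [/eqP Iv|Iv] /= := boolP (nbrs _ _ _ == set0).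
  rewrite /move /= Iv cards0 setD0; case: c => [b|] /=; first by rewrite put_big_tiles.
  by rewrite put_smalls_tiles // Iv eqxx orbT.
rewrite /move /=; case: c => [[]|] /=; last first.
- by rewrite (setDidPl _) // disjoint_sym disjoints1.
- by rewrite leqn0 cards_eq0 (negPf Iv).
case: pickP => [u|nou].
  rewrite drag_ok_tiles // => /eqP Ivu; rewrite Ivu cards1 /=.
  have uI : u \in I by have := set11 u; rewrite -Ivu inE => /andP[].
  by rewrite /drag put_smalls_tiles ?uI // put_big_tiles.
case: ifP => //; rewrite leq_eqVlt ltnS leqn0 cards_eq0 (negPf Iv) orbF.
by move=> /cards1P[u Iu]; have := nou u; rewrite drag_ok_tiles // Iu eqxx.
Qed.

Lemma packing_independent I : (1 < n)%N -> packing I = independent (@adjacent n) I.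
Proof.
move=> n1; rewrite /packing; case: independent => //=.
by apply/forall_inP => v _; apply: uniq_block.
Qed.

Lemma packing_small_torus I : (n <= 1)%N -> packing I -> I = set0.
Proof.
move=> n1 /andP[_ /forall_inP Iuniq]; apply/setP => v; rewrite inE.
have ord_irr (i j : 'I_n) : i = j.
  apply: val_inj; have := leq_trans (ltn_ord i) n1; have := leq_trans (ltn_ord j) n1.
  by rewrite !ltnS !leqn0 => /eqP j0 /eqP i0; apply: etrans i0 (esym j0).
apply/negP => /Iuniq; case: v => i j.
by rewrite /block (ord_irr (ordS i) i) (ord_irr (ordS j) j) /= inE eqxx.
Qed.

Lemma tile_move_small_torus I r : (n <= 1)%N -> packing I -> tile_move r (tiles I) = tiles I.
Proof.
move=> n1 Ipack; have I0 := packing_small_torus n1 Ipack.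
(* Otherwise the single square at [v] would be a nonempty packing. *)
have nouniq v : uniq (block v) = false.
  apply/negP => uv; have : [set v] = set0.
    apply: (packing_small_torus n1); rewrite /packing; apply/andP; split.
      by apply/independentP => u w /set1P-> /set1P->; rewrite adjacentxx.
    by apply/forall_inP => u /set1P->.
  by move/setP => /(_ v); rewrite !inE eqxx.
rewrite /tile_move /central_ok /has_big /four_smalls nouniq I0 big_tiles inE /=.
case: r.2 => [[]|] //; case: pickP => // u.
by rewrite /drag_ok /has_big big_tiles inE.
Qed.

Lemma tile_move_tiling r X : is_tiling X -> is_tiling (tile_move r X).
Proof.
move=> /tiling_packing[Ipack ->]; have [n1|n1] := leqP n 1.
  by rewrite tile_move_small_torus // tiles_tiling.
rewrite tile_move_tiles // tiles_tiling //.
by move: Ipack; rewrite !packing_independent //; apply: move_independent adjacentC adjacentxx _ _.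
Qed.

Definition tiling_move r (X : tiling n) : tiling n := insubd X (tile_move r (val X)).

Lemma val_tiling_move r (X : tiling n) : val (tiling_move r X) = tile_move r (val X).
Proof. by rewrite val_insubd tile_move_tiling // (valP X). Qed.

Lemma bigs_tiling_move r (X : tiling n) : (1 < n)%N ->
  bigs (val (tiling_move r X)) = move (@adjacent n) r (bigs (val X)).
Proof.
move=> n1; rewrite val_tiling_move; have [Ipack XE] := tiling_packing (valP X).
by rewrite [in LHS]XE tile_move_tiles // bigs_tiles.
Qed.

Lemma bigs_independent (X : tiling n) : independent (@adjacent n) (bigs (val X)).
Proof. by have [/andP[]] := tiling_packing (valP X). Qed.

Lemma bigs_inj : injective (fun X : tiling n => bigs (val X)).
Proof.
move=> X Y XY; apply: val_inj; have [_ ->] := tiling_packing (valP X).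
by have [_ ->] := tiling_packing (valP Y); rewrite -/(bigs _) XY.
Qed.

Lemma tiling_small_torus (X Y : tiling n) : (n <= 1)%N -> X = Y.
Proof.
move=> n1; apply: bigs_inj => /=.
have [Xp _] := tiling_packing (valP X); have [Yp _] := tiling_packing (valP Y).
by rewrite (packing_small_torus n1 Xp) (packing_small_torus n1 Yp).
Qed.

End Tilings.

(** * Mixing of the tiling chain *)

Section TilingChain.
Variables (R : realType) (lambda : R) (n : nat).
Hypotheses (lambda_gt0 : 0 < lambda) (n_gt0 : (0 < n)%N).
Implicit Types (X Y Z : tiling n).

Definition p_delete : R := 1 / (lambda + 1).
Definition p_drag : R := lambda / (4 * (lambda + 1)).

Lemma p_delete_gt0 : 0 < p_delete.
Proof. by have := lambda_gt0 => l0; rewrite divr_gt0 //; lra. Qed.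

Lemma p_drag_gt0 : 0 < p_drag.
Proof. by have := lambda_gt0 => l0; rewrite divr_gt0 //; lra. Qed.

Lemma p_delete_drag : p_delete + 4 * p_drag = 1.
Proof. by have := lambda_gt0 => l0; rewrite /p_delete /p_drag; field; lra. Qed.

Lemma p_delete_lambda : p_delete * lambda = 4 * p_drag.
Proof. by have := lambda_gt0 => l0; rewrite /p_delete /p_drag; field; lra. Qed.

Lemma card_site : #|{: site n}| = (n ^ 2)%N.
Proof. by rewrite card_prod card_ord. Qed.

Lemma card_site_gt0 : (0 < #|{: site n}|)%N.
Proof. by rewrite card_site expn_gt0 n_gt0. Qed.

Notation weights := (@seed_weight (site n) R p_delete p_drag).

Lemma MC_square_maps X Y :
  MC_square lambda X Y = \sum_r weights r * (tiling_move r X == Y)%:R.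
Proof.
have l0 : lambda + 1 != 0 by have := lambda_gt0 => l0; rewrite gt_eqF //; lra.
rewrite sum_seed_weight card_site /MC_square; congr (_ / _).
apply: eq_bigr => v _; rewrite sum_coin_weight -!val_eqE !val_tiling_move.
rewrite /site_step /tile_move /= -/p_delete -/p_drag ![val Y == _]eq_sym.
case: ifP => _; first by rewrite /p_delete /p_drag; field.
(* When a drag is possible, the coins that do nothing have total weight [p_delete + 3 * p_drag],
   that is [1 - p_drag]. *)
have -> : p_delete = 1 - 4 * p_drag by have := p_delete_drag; lra.
by case: pickP => [u _|_]; rewrite ?[val Y == _]eq_sym; ring.
Qed.

Lemma weight_gt0 X : 0 < weight lambda X.
Proof. exact: exprn_gt0. Qed.

Lemma partition_gt0 : 0 < \sum_(Y : tiling n) weight lambda Y.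
Proof.
(* The empty packing is the tiling by unit squares alone. *)
have p0 : packing (set0 : {set site n}).
  by apply/andP; split; [apply/independentP => u v | apply/forall_inP => v]; rewrite inE.
have X0 : tiling n by exists (tiles set0); apply: tiles_tiling.
rewrite (bigD1 X0) //= ltr_wpDr ?weight_gt0 //.
by apply: sumr_ge0 => Y _; apply/ltW/weight_gt0.
Qed.

Lemma gibbs_ge0 X : 0 <= gibbs lambda X.
Proof. by rewrite divr_ge0 ?ltW ?weight_gt0 ?partition_gt0. Qed.

Lemma gibbs_sum : \sum_(X : tiling n) gibbs lambda X = 1.
Proof. by rewrite -mulr_suml divff // gt_eqF ?partition_gt0. Qed.

Lemma MC_square_reversible X Y :
  gibbs lambda X * MC_square lambda X Y = gibbs lambda Y * MC_square lambda Y X.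
Proof.
have [n1|n1] := leqP n 1; first by rewrite (tiling_small_torus X Y n1).
rewrite /gibbs mulrAC [RHS]mulrAC; congr (_ / _).
rewrite /weight !nb_bigE !MC_square_maps.
have maps Z W r : (tiling_move r Z == W) =
    (move (@adjacent n) r (bigs (val Z)) == bigs (val W)).
  by rewrite -bigs_tiling_move // (inj_eq (@bigs_inj n)).
under eq_bigr do rewrite maps; under [in RHS]eq_bigr do rewrite maps.
exact: (move_reversible (@adjacentC n) p_delete_lambda (bigs_independent X) (bigs_independent Y)).
Qed.

Lemma tiling_mixing_time t (eps B : R) :
  (forall X Z, uncoupled weights (@tiling_move n) t X Z <= eps) -> t%:R <= B ->
  (mixing_time (@MC_square R n lambda) (@gibbs R n lambda) eps <= B%:E)%E.
Proof.
apply: mixing_time_le_uncoupled => //.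
- by move=> r; apply: seed_weight_ge0; rewrite ltW ?p_delete_gt0 ?p_drag_gt0.
- by apply: sum_seed_weight1; [exact: p_delete_drag | exact: card_site_gt0].
- exact: MC_square_maps.
- exact: gibbs_ge0.
- exact: gibbs_sum.
- exact: MC_square_reversible.
Qed.

Lemma tiling_mixing_time_small (eps B : R) : (n <= 1)%N -> 0 <= eps -> 0 <= B ->
  (mixing_time (@MC_square R n lambda) (@gibbs R n lambda) eps <= B%:E)%E.
Proof.
move=> n1 eps0; apply: (@tiling_mixing_time 0) => X Z.
by rewrite (tiling_small_torus X Z n1) uncoupled_same.
Qed.

Hypothesis n_gt1 : (1 < n)%N.
Local Notation tdist X Z := (hdist (bigs (val X)) (bigs (val Z)))%:R.

Lemma tdist_ge1 X Z : (X != Z)%:R <= tdist X Z :> R.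
Proof.
rewrite ler_nat; case: eqVneq => //= XZ; rewrite lt0n; apply: contraNneq XZ.
by move/hdist_eq0 => XZ; apply/eqP/bigs_inj.
Qed.

Lemma tdist_le X Z : tdist X Z <= n%:R ^+ 2 :> R.
Proof. by rewrite -natrX -card_site ler_nat hdist_le_card. Qed.

(** The constant 16 is twice the degree bound 8. The distance starts at most [n ^ 2], and it is at
    least 1 while the copies differ. *)
Lemma tiling_uncoupled_contract t X Z : 16 * p_drag <= 1 ->
  uncoupled weights (@tiling_move n) t X Z <=
  (1 - (1 - 16 * p_drag) / n%:R ^+ 2) ^+ t * n%:R ^+ 2.
Proof.
move=> sub; set k := 1 - _ / _.
have N1 : 1 <= n%:R ^+ 2 :> R by rewrite exprn_ege1 // ler1n.
have k0 : 0 <= k.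
  rewrite subr_ge0 ler_pdivrMr ?mul1r; last by lra.
  by have := p_drag_gt0; lra.
have wge0 r : 0 <= weights r.
  by apply: seed_weight_ge0; rewrite ltW ?p_delete_gt0 ?p_drag_gt0.
apply: (@le_trans _ _ (k ^+ t * tdist X Z)); last first.
  by rewrite ler_wpM2l ?exprn_ge0 ?tdist_le.
rewrite -[leLHS]mul1r.
apply: (uncoupled_supersolution wge0 (u := fun s X Z => k ^+ s * tdist X Z)) => {X Z t}.
  by move=> X Z; rewrite !mul1r; apply: tdist_ge1.
move=> s X Z; rewrite coupled_avgZ exprSr -[leRHS]mulrA.
rewrite ler_wpM2l ?exprn_ge0 // /coupled_avg.
under eq_bigr do rewrite !bigs_tiling_move //.
have := hdist_contract (@adjacentxx n) (ltW p_delete_gt0) (ltW p_drag_gt0) p_delete_drag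
  (@adjacent_degree n) (bigs_independent X) (bigs_independent Z).
rewrite card_site natrX (_ : 2 * p_drag * 8%:R = 16 * p_drag); last by ring.
by [].
Qed.

(** Since [rate] is 1 at time 0, the supersolution starts at or above [1 - expR (-1)] on distinct
    copies. At time [s] it is bounded by [1 - expR (- x) <= x] and the diameter [n ^ 2]. *)
Lemma tiling_uncoupled_critical s X Z : 16 * p_drag <= 1 ->
  (1 - expR (-1)) * uncoupled weights (@tiling_move n) s X Z <=
  rate (site n) p_delete s * n%:R ^+ 2.
Proof.
move=> sub.
have wge0 r : 0 <= weights r.
  by apply: seed_weight_ge0; rewrite ltW ?p_delete_gt0 ?p_drag_gt0.
have r0 : 0 <= rate (site n) p_delete s.
  rewrite invr_ge0 addr_ge0 // mulr_ge0 //; apply: divr_ge0; last by rewrite mulr_ge0.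
  exact: ltW p_delete_gt0.
apply: (@le_trans _ _ (1 - expR (- (rate (site n) p_delete s * tdist X Z)))); last first.
  apply: (@le_trans _ _ (rate (site n) p_delete s * tdist X Z)).
    have := expR_ge1Dx (- (rate (site n) p_delete s * tdist X Z)); lra.
  by rewrite ler_wpM2l ?tdist_le.
apply: (uncoupled_supersolution wge0
  (u := fun s X Z => 1 - expR (- (rate (site n) p_delete s * tdist X Z)))) => {X Z s r0}.
  move=> X Z; have := tdist_ge1 X Z; rewrite /rate mulr0 addr0 invr1 mul1r.
  case: (X != Z) => d1; last first.
    by rewrite mulr0 subr_ge0 -expR0 ler_expR oppr_le0.
  by rewrite mulr1 lerD2l lerN2 ler_expR lerN2.
move=> s X Z; rewrite /coupled_avg.
under eq_bigr do rewrite !bigs_tiling_move //.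
apply: (hdist_supersolution (@adjacentxx n) (ltW p_delete_gt0) (ltW p_drag_gt0)
  p_delete_drag (@adjacent_degree n) _ card_site_gt0 _
  (bigs_independent X) (bigs_independent Z)).
by rewrite (_ : 2 * p_drag * 8%:R = 16 * p_drag) //; ring.
Qed.

End TilingChain.

Lemma nat_ceilP (R : realType) (x : R) : 0 <= x ->
  exists t : nat, [/\ t%:R = (Num.ceil x)%:~R :> R, x <= t%:R & t%:R <= x + 1].
Proof.
move=> x0; have c0 : 0 <= Num.ceil x by rewrite ceil_ge0; lra.
have cE : `|Num.ceil x|%N%:R = (Num.ceil x)%:~R :> R by rewrite natr_absz ger0_norm.
exists `|Num.ceil x|%N; rewrite cE; split=> //; first exact: ceil_ge.
by have := ceilB1_lt x; rewrite intrB; lra.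
Qed.

(** * Explicit mixing time bounds in the two regimes *)

Section Bounds.
Variables (R : realType) (lambda : R).
Hypothesis lambda_gt0 : 0 < lambda.

(** With [N] for [n ^ 2], the number of steps is [N / beta * ln (N / eps)] rounded up. *)
Lemma mixing_time_subcritical (n : nat) (eps : R) :
  16 * p_drag lambda < 1 -> (1 < n)%N -> 0 < eps <= 1 ->
  (mixing_time (@MC_square R n lambda) (@gibbs R n lambda) eps
   <= ((2 / (1 - 16 * p_drag lambda) + 1) * n%:R ^+ 2 * ln (n%:R * eps^-1))%:E)%E.
Proof.
move=> sub n1 /andP[eps0 eps1]; have n0 := ltnW n1.
set beta := 1 - 16 * p_drag lambda; have beta0 : 0 < beta by rewrite /beta; lra.
pose N : R := n%:R ^+ 2.
have n2 : 2 <= n%:R :> R by rewrite (ler_nat R 2).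
have N4 : 4 <= N by rewrite /N; nra.
have ieps1 : 1 <= eps^-1 by rewrite invf_ge1.
(* The square root of e is at most 2, hence at most [n / eps]. *)
have L2 : 2^-1 <= ln (n%:R * eps^-1).
  rewrite -(expRK (2^-1 : R)) ler_ln ?posrE ?expR_gt0 //; last by nra.
  by apply: le_trans (expR_le_1D2x _) _; [rewrite lexx andbT invr_ge0 | rewrite divff //; nra].
(* As [eps <= 1], [N / eps] is at most the square of [n / eps]; this is the 2 in the constant. *)
have LN : ln (N * eps^-1) <= 2 * ln (n%:R * eps^-1).
  rewrite mulr_natl -lnXn; last by nra.
  rewrite ler_ln ?posrE; [|nra|by rewrite exprn_gt0 //; nra].
  by rewrite exprMn ler_wpM2l //; nra.
have LN0 : 0 <= ln (N * eps^-1) by apply: ln_ge0; nra.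
have N0 : 0 <= N by lra.
have [t [_ tx t_le]] := nat_ceilP (mulr_ge0 (divr_ge0 N0 (ltW beta0)) LN0).
apply: (tiling_mixing_time lambda_gt0 n0 (t := t)) => [X Z|].
  apply: le_trans (tiling_uncoupled_contract lambda_gt0 n0 n1 t X Z (ltW sub)) _.
  rewrite -/beta -/N.
  have e1 : 1 - beta / N <= expR (- (beta / N)) by apply: expR_ge1Dx.
  have k0 : 0 <= 1 - beta / N.
    rewrite subr_ge0 ler_pdivrMr; last by lra.
    by have := p_drag_gt0 lambda_gt0; rewrite /beta; lra.
  apply: (@le_trans _ _ (expR (- ln (N * eps^-1)) * N)).
    rewrite ler_wpM2r //; apply: (@le_trans _ _ (expR (- (beta / N)) ^+ t)).
      by rewrite lerXn2r ?nnegrE ?expR_ge0.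
    rewrite -expRM_natr ler_expR mulNr lerN2.
    have bN : 0 < beta / N by rewrite divr_gt0 //; lra.
    apply: le_trans (ler_wpM2l (ltW bN) tx).
    rewrite le_eqVlt; apply/orP; left; apply/eqP; field.
    by rewrite !gt_eqF //; lra.
  rewrite expRN lnK ?posrE; last by rewrite mulr_gt0 ?invr_gt0 //; lra.
  by rewrite le_eqVlt; apply/orP; left; apply/eqP; field; rewrite !gt_eqF //; lra.
apply: le_trans t_le _; rewrite -/N.
have bi : 0 < beta^-1 by rewrite invr_gt0.
have s1 : N / beta * ln (N * eps^-1) <= N / beta * (2 * ln (n%:R * eps^-1)).
  by rewrite ler_wpM2l // mulr_ge0 ?ltW //; lra.
(* The summand 1 in the constant pays for rounding up the number of steps. *)
have s2 : 2 * 2^-1 <= N * ln (n%:R * eps^-1) by apply: ler_pM => //; lra.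
have -> : (2 / beta + 1) * N * ln (n%:R * eps^-1) =
    N / beta * (2 * ln (n%:R * eps^-1)) + N * ln (n%:R * eps^-1) by ring.
lra.
Qed.

(** After [K * n ^ 4] steps, [rate] times [n ^ 2] is below [8 / (a * K)] with [a] the deletion
    probability, a bound free of [n]; the hypothesis on [K] makes it small enough. *)
Lemma critical_coupling (n K : nat) (X Z : tiling n) :
  16 * p_drag lambda = 1 -> (1 < n)%N ->
  8 / (p_delete lambda * ((1 - expR (-1)) * expR (-1))) <= K%:R ->
  uncoupled (@seed_weight (site n) R (p_delete lambda) (p_drag lambda))
    (@tiling_move n) (K * n ^ 4) X Z <= expR (-1).
Proof.
move=> crit n1 hK; have n0 := ltnW n1.
have a0 := p_delete_gt0 lambda_gt0.
have e0 : 0 < expR (-1) :> R := expR_gt0 _.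
have e1 : expR (-1) < 1 :> R by rewrite expR_lt1; lra.
have c0 : 0 < 1 - expR (-1) :> R by lra.
have N0 : 0 < n%:R ^+ 2 :> R by rewrite exprn_gt0 // ltr0n.
have ace : 0 < p_delete lambda * ((1 - expR (-1)) * expR (-1)).
  by apply: mulr_gt0 => //; apply: mulr_gt0.
have crit' : 16 * p_drag lambda <= 1 by rewrite crit.
have := tiling_uncoupled_critical lambda_gt0 n0 n1 (K * n ^ 4) X Z crit'.
move=> unc; rewrite -(ler_pM2l c0); apply: le_trans unc _.
rewrite /rate card_site natrM !natrX -[n%:R ^+ 4]/(n%:R ^+ (2 * 2)) exprM.
move: a0 ace hK N0; move: (p_delete lambda) K%:R (n%:R ^+ 2) => a k N a0 ace hK N0.
have k0 : 0 < k by rewrite (lt_le_trans _ hK) // divr_gt0.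
have den : a / (8 * N) * (k * N ^+ 2) = a * k / 8 * N by field; rewrite gt_eqF.
have akN : 0 < a * k / 8 * N by rewrite !mulr_gt0.
rewrite den mulrC ler_pdivrMr; last by lra.
rewrite ler_pdivrMr // in hK; nra.
Qed.

(** Each block of [K * n ^ 4] steps fails with probability at most [expR (-1)]. The number [m] of
    blocks is at least [ln (1 / eps)] because [ln n + 1 >= 1]. *)
Lemma mixing_time_critical (K n : nat) (eps : R) :
  16 * p_drag lambda = 1 -> (1 < n)%N -> 0 < eps <= 1 ->
  8 / (p_delete lambda * ((1 - expR (-1)) * expR (-1))) <= K%:R ->
  (mixing_time (@MC_square R n lambda) (@gibbs R n lambda) eps
   <= (K%:R * n%:R ^+ 4 * (Num.ceil ((ln n%:R + 1) * ln eps^-1))%:~R)%:E)%E.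
Proof.
move=> crit n1 /andP[eps0 eps1] hK; have n0 := ltnW n1.
have ln0 : 0 <= ln n%:R :> R by rewrite ln_ge0 // ler1n.
have le0 : 0 <= ln eps^-1 by rewrite ln_ge0 // invf_ge1.
have x0 : 0 <= (ln n%:R + 1) * ln eps^-1 by rewrite mulr_ge0 // addr_ge0.
have [m [<- mx _]] := nat_ceilP x0.
apply: (tiling_mixing_time lambda_gt0 n0 (t := (m * (K * n ^ 4))%N)) => [X Z|]; last first.
  by rewrite natrM natrM natrX mulrC.
have wge0 r : 0 <= @seed_weight (site n) R (p_delete lambda) (p_drag lambda) r.
  by apply: seed_weight_ge0; rewrite ltW ?p_delete_gt0 ?p_drag_gt0.
have wsum : \sum_r @seed_weight (site n) R (p_delete lambda) (p_drag lambda) r = 1.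
  by apply: sum_seed_weight1; [exact: p_delete_drag | exact: card_site_gt0].
apply: le_trans (uncoupled_expn wge0 wsum (expR_ge0 _) _ m X Z) _.
  by move=> {}X {}Z; apply: critical_coupling.
rewrite -expRM_natr mulN1r -[leRHS]lnK // ler_expR lerNl -lnV //.
by apply: le_trans mx; rewrite ler_peMl // lerDr.
Qed.

End Bounds.

Theorem theorem5 (R : realType) (lambda : R) (hlambda : 0 < lambda) :
  exists c1 c2 : R, [/\ 0 < c1, 0 < c2,
    lambda < 3^-1 ->
      forall (n : nat) (eps : R), (0 < n)%N -> 0 < eps <= 1 ->
        (mixing_time (@MC_square R n lambda) (@gibbs R n lambda) eps
         <= (c1 * n%:R ^+ 2 * ln (n%:R * eps^-1))%:E)%E
    & lambda = 3^-1 ->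
      forall (n : nat) (eps : R), (0 < n)%N -> 0 < eps <= 1 ->
        (mixing_time (@MC_square R n lambda) (@gibbs R n lambda) eps
         <= (c2 * n%:R ^+ 4
             * (Num.ceil ((ln n%:R + 1) * ln eps^-1))%:~R)%:E)%E].
Proof.
(* The constant must be positive for every [lambda], while the subcritical formula can be negative
   above 1/3. *)
pose c1 : R := if lambda < 3^-1 then 2 / (1 - 16 * p_drag lambda) + 1 else 1.
pose K := Num.bound (8 / (p_delete lambda * ((1 - expR (-1)) * expR (-1)))).
have sub : lambda < 3^-1 -> 16 * p_drag lambda < 1.
  by move=> l3; rewrite /p_drag mulrA ltr_pdivrMr; lra.
have crit : lambda = 3^-1 -> 16 * p_drag lambda = 1.
  by move=> ->; rewrite /p_drag; field.
have bound0 : 0 <= 8 / (p_delete lambda * ((1 - expR (-1)) * expR (-1))).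
  apply: divr_ge0 => //; apply: mulr_ge0; first exact: ltW (p_delete_gt0 hlambda).
  by apply: mulr_ge0; rewrite ?expR_ge0 // subr_ge0 expR_le1; lra.
have hK := archi_boundP bound0; rewrite -/K in hK.
have K0 : 0 < K%:R :> R := le_lt_trans bound0 hK.
have c1_gt0 : 0 < c1.
  by rewrite /c1; case: ifP => // /sub sub'; rewrite addr_gt0 // divr_gt0 //; lra.
exists c1, K%:R; split=> // l3 n eps n0 /andP[eps0 eps1].
  (* On the 1 x 1 torus a singleton is independent but gives no tiling, so the reduction to the
     hard-core model fails; there is only one tiling, already mixed at time 0. *)
  have [n1|n1] := leqP n 1.
    have nE : n%:R = 1 :> R by have -> : n = 1%N by apply/eqP; rewrite eqn_leq n1 n0.
    apply: tiling_mixing_time_small => //; first exact: ltW.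
    by rewrite nE expr1n mulr1 mul1r mulr_ge0 ?(ltW c1_gt0) // ln_ge0 // invf_ge1.
  by rewrite /c1 l3; apply: mixing_time_subcritical; rewrite ?sub ?eps0.
have [n1|n1] := leqP n 1; last by apply: mixing_time_critical; rewrite ?crit ?eps0 // ltW.
apply: tiling_mixing_time_small => //; first exact: ltW.
rewrite !mulr_ge0 ?exprn_ge0 // ler0z ceil_ge0 (@lt_le_trans _ _ 0) //.
by rewrite mulr_ge0 ?addr_ge0 ?ln_ge0 ?ler1n ?invf_ge1.
Qed.
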